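(* If $L$ is a rigid group, then $L^\omega$ is a Hall-group.
   Context: $\omega=\{0,1,2,\ldots\}$, and $S_\omega$ is the full symmetric group of all permutations of $\omega$. For a group $A$, $A^\omega$ is the (full, unrestricted) cartesian power of countably many copies of $A$. $\operatorname{Aut} A$ and $\operatorname{Inn} A$ are the groups of automorphisms and of inner automorphisms of $A$; $\operatorname{Hom}(A,B)$ is the set of group homomorphisms $A \to B$; $\operatorname{End} A = \operatorname{Hom}(A,A)$; $0$ denotes the trivial homomorphism sending every element to $1$, and $\operatorname{Hom}(A,B)=0$ means that the trivial homomorphism is the only one. A group $L \neq 1$ is called rigid if: (i) $L$ is complete, i.e. $L$ has trivial center and $\operatorname{Aut} L = \operatorname{Inn} L$; (ii) $\operatorname{Hom}(L^\omega, S_\omega) = 0$; (iii) $\operatorname{End} L = \operatorname{Inn} L \cup \{0\}$. A group $G$ is called a Hall-group if every group $H$ containing $G$ as a normal subgroup with $H/G \cong G$ is isomorphic to $G$. *)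

(* Defs.v *)
From HB Require Import structures.
From mathcomp Require Import all_boot.
From mathcomp Require Import boolp classical_sets.

Set Implicit Arguments.
Unset Strict Implicit.
Unset Printing Implicit Defensive.

Local Open Scope quotient_scope.
Local Open Scope classical_set_scope.
Local Open Scope group_scope.

(* [groupType] carries a [choiceType] structure; in the presence of the axioms
   of [boolp] every type has one, so this does not restrict the groups. *)

Definition Hom (A B : groupType) : set (A -> B) :=
  [set f | monoid_morphism f].
Arguments Hom : clear implicits.

Definition End (A : groupType) : set (A -> A) := Hom A A.

Definition Aut (A : groupType) : set (A -> A) :=
  [set f | Hom A A f /\ bijective f].

Definition Inn (A : groupType) : set (A -> A) :=
  [set f | exists a : A, f = (fun x => x ^ a)].

Arguments End : clear implicits.
Arguments Aut : clear implicits.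
Arguments Inn : clear implicits.

Definition trivHom (A B : groupType) : A -> B := fun=> 1.
Arguments trivHom : clear implicits.

Definition isomorphic (A B : groupType) : Prop :=
  exists f : A -> B, Hom A B f /\ bijective f.

Definition center (A : groupType) : set A :=
  [set z | forall x : A, commute z x].
Arguments center : clear implicits.

Section Power.
Variables (I : Type) (A : groupType).
Implicit Types f g h : I -> A.

Definition power_one : I -> A := fun=> 1.
Definition power_inv f : I -> A := fun i => (f i)^-1.
Definition power_mul f g : I -> A := fun i => f i * g i.

Fact power_mulA : associative power_mul.
Proof. by move=> f g h; apply/funext => i; rewrite /power_mul mulgA. Qed.

Fact power_mul1 : left_id power_one power_mul.
Proof. by move=> f; apply/funext => i; rewrite /power_mul mul1g. Qed.

Fact power_mulr1 : right_id power_one power_mul.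
Proof. by move=> f; apply/funext => i; rewrite /power_mul mulg1. Qed.

Fact power_mulV : left_inverse power_one power_inv power_mul.
Proof. by move=> f; apply/funext => i; rewrite /power_mul mulVg. Qed.

Fact power_mulrV : right_inverse power_one power_inv power_mul.
Proof. by move=> f; apply/funext => i; rewrite /power_mul mulgV. Qed.

HB.instance Definition _ := isGroup.Build (I -> A)
  power_mulA power_mul1 power_mulr1 power_mulV power_mulrV.

End Power.

Record sym (T : Type) := Sym {
  sym_fun :> T -> T;
  sym_funP : `[< bijective sym_fun >]
}.

Section Symmetric.
Variable T : choiceType.

HB.instance Definition _ := [isSub for @sym_fun T].
HB.instance Definition _ := [Choice of sym T by <:].

Implicit Types f g h : sym T.

Definition sym_of (f : T -> T) (f_bij : bijective f) : sym T :=
  Sym (asboolT f_bij).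

Lemma sym_bij f : bijective f.
Proof. exact/asboolP/sym_funP. Qed.

Fact sym_inv_subproof f : exists g : sym T,
  cancel f g /\ cancel g f.
Proof.
case: (sym_bij f) => g fK gK.
by exists (sym_of (Bijective gK fK)).
Qed.

Definition sym_one : sym T :=
  sym_of (Bijective (@frefl T T id) (@frefl T T id)).
Definition sym_mul f g : sym T := sym_of (bij_comp (sym_bij f) (sym_bij g)).
Definition sym_inv f : sym T := projT1 (cid (sym_inv_subproof f)).

Fact sym_mulA : associative sym_mul.
Proof. by move=> f g h; apply/val_inj. Qed.

Fact sym_mul1 : left_id sym_one sym_mul.
Proof. by move=> f; apply/val_inj. Qed.

Fact sym_mulr1 : right_id sym_one sym_mul.
Proof. by move=> f; apply/val_inj. Qed.

Fact sym_mulV : left_inverse sym_one sym_inv sym_mul.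
Proof.
move=> f; apply/val_inj/funext => x; rewrite /sym_inv.
by case: cid => g [fK gK] /=; apply: fK.
Qed.

Fact sym_mulrV : right_inverse sym_one sym_inv sym_mul.
Proof.
move=> f; apply/val_inj/funext => x; rewrite /sym_inv.
by case: cid => g [fK gK] /=; apply: gK.
Qed.

HB.instance Definition _ := isGroup.Build (sym T)
  sym_mulA sym_mul1 sym_mulr1 sym_mulV sym_mulrV.

End Symmetric.

HB.mixin Record isConjClosed (G : groupType) (N : {pred G}) := {
  gpred_conj : forall x y : G, x \in N -> x ^ y \in N
}.

#[short(type="normalSubgroup")]
HB.structure Definition NormalSubgroup (G : groupType) :=
  {N of GroupClosed G N & isConjClosed G N}.

Definition subgroup (G : groupType) (N : groupClosed G) : Type :=
  {x : G | x \in N}.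

Section Subgroup.
Variables (G : groupType) (N : groupClosed G).

HB.instance Definition _ := SubType.on (subgroup N).
HB.instance Definition _ := Choice.on (subgroup N).

Fact subgroup_closed : group_closed (mem N).
Proof. by split; [apply: gpred1 | move=> x y; apply: gpredF]. Qed.

HB.instance Definition _ :=
  SubChoice_isSubGroup.Build G _ (subgroup N) subgroup_closed.

End Subgroup.

Section Quotient.
Variables (G : groupType) (N : normalSubgroup G).

(* Equality of the cosets x N and y N. *)
Definition coset_eq : rel G := fun x y => x^-1 * y \in N.

Fact coset_eq_refl : reflexive coset_eq.
Proof. by move=> x; rewrite /coset_eq mulVg gpred1. Qed.

Fact coset_eq_sym : symmetric coset_eq.
Proof. by move=> x y; rewrite /coset_eq -gpredV invgM invgK. Qed.

Fact coset_eq_trans : transitive coset_eq.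
Proof.
move=> y x z xy yz; rewrite /coset_eq.
by rewrite -(mulgK y x^-1) -mulgA gpredM // -(invgK x) // invgK.
Qed.

Canonical coset_eq_equiv : equiv_rel G :=
  EquivRel coset_eq coset_eq_refl coset_eq_sym coset_eq_trans.

Definition quotient : Type := {eq_quot coset_eq}.
HB.instance Definition _ := EqQuotient.on quotient.
HB.instance Definition _ := Choice.on quotient.

Definition quotient_one : quotient := \pi_quotient 1.
Definition quotient_inv (X : quotient) : quotient := \pi_quotient (repr X)^-1.
Definition quotient_mul (X Y : quotient) : quotient :=
  \pi_quotient (repr X * repr Y).

Lemma quotient_eqP (x y : G) :
  reflect (\pi_quotient x = \pi_quotient y) (x^-1 * y \in N).
Proof. exact: (@EquivQuot.eqmodP _ _ _ _ coset_eq_equiv _ x y). Qed.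

Lemma quotient_mulE (x y : G) :
  quotient_mul (\pi x) (\pi y) = \pi_quotient (x * y).
Proof.
have /quotient_eqP Nx : \pi_quotient (repr (\pi_quotient x)) = \pi_quotient x.
  exact: reprK.
have /quotient_eqP Ny : \pi_quotient (repr (\pi_quotient y)) = \pi_quotient y.
  exact: reprK.
apply/quotient_eqP; move: (repr (\pi_quotient x)) Nx => x' Nx.
move: (repr (\pi_quotient y)) Ny => y' Ny.
have -> : (x' * y')^-1 * (x * y) = (x'^-1 * x) ^ y' * (y'^-1 * y).
  by rewrite /conjg invgM !mulgA mulgK.
by rewrite gpredM // gpred_conj.
Qed.

Lemma quotient_invE (x : G) : quotient_inv (\pi x) = \pi_quotient x^-1.
Proof.
have /quotient_eqP Nx : \pi_quotient (repr (\pi_quotient x)) = \pi_quotient x.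
  exact: reprK.
apply/quotient_eqP; move: (repr _) Nx => x' Nx; rewrite invgK.
have -> : x' * x^-1 = ((x'^-1 * x) ^ x'^-1)^-1.
  by rewrite /conjg invgK !mulgA mulgV mul1g invgM invgK.
by rewrite gpredV gpred_conj.
Qed.

Fact quotient_mulA : associative quotient_mul.
Proof.
elim/quotW=> x; elim/quotW=> y; elim/quotW=> z.
by rewrite !quotient_mulE mulgA.
Qed.

Fact quotient_mul1 : left_id quotient_one quotient_mul.
Proof. by elim/quotW=> x; rewrite quotient_mulE mul1g. Qed.

Fact quotient_mulr1 : right_id quotient_one quotient_mul.
Proof. by elim/quotW=> x; rewrite quotient_mulE mulg1. Qed.

Fact quotient_mulV : left_inverse quotient_one quotient_inv quotient_mul.
Proof. by elim/quotW=> x; rewrite quotient_invE quotient_mulE mulVg. Qed.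

Fact quotient_mulrV : right_inverse quotient_one quotient_inv quotient_mul.
Proof. by elim/quotW=> x; rewrite quotient_invE quotient_mulE mulgV. Qed.

HB.instance Definition _ := isGroup.Build quotient
  quotient_mulA quotient_mul1 quotient_mulr1 quotient_mulV quotient_mulrV.

End Quotient.

Definition complete (L : groupType) : Prop :=
  center L = [set 1] /\ Aut L = Inn L.

Definition rigid (L : groupType) : Prop :=
  [/\ [set: L] <> [set 1],
      complete L,
      Hom (nat -> L) (sym nat) = [set trivHom (nat -> L) (sym nat)] &
      End L = Inn L `|` [set trivHom L L]].

(* "H contains G as a normal subgroup" is read up to isomorphism: H has a
   normal subgroup N isomorphic to G. *)
Definition HallGroup (G : groupType) : Prop :=
  forall (H : groupType) (N : normalSubgroup H),
    isomorphic (subgroup N) G -> isomorphic (quotient N) G -> isomorphic H G.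

(* Main.v *)
(* If 1 -> L^w -> H -> L^w -> 1 is exact, H acts by conjugation on the kernel.
   Because the centre of L is trivial and End L = Inn L + 0, an automorphism of
   L^w permutes the coordinate copies of L, and it is inner as soon as it fixes
   each of them.  Hence H maps to S_w with the kernel acting trivially, so this
   map factors through L^w and is trivial by Hom (L^w, S_w) = 0.  Thus H acts
   by inner automorphisms, and as L^w is centreless the extension splits as a
   direct product L^w x L^w, which is isomorphic to L^w. *)
Require Import Defs.
From mathcomp Require Import all_boot.
From mathcomp Require Import boolp classical_sets.

Set Implicit Arguments.
Unset Strict Implicit.
Unset Printing Implicit Defensive.

Local Open Scope group_scope.

Definition surjective (A B : Type) (f : A -> B) := forall y, exists x, f x = y.

Lemma inj_surj_bij (A B : Type) (f : A -> B) :
  injective f -> surjective f -> bijective f.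
Proof.
move=> f_inj /choice[g gK]; exists g => // x.
by apply: f_inj; rewrite gK.
Qed.

(** * Homomorphisms and conjugation *)

Section Homomorphisms.
Variables (A B : groupType).

Lemma HomM (f : A -> B) : {morph f : x y / x * y} -> Hom A B f.
Proof.
by move=> fM; split=> //; apply: (mulgI (f 1)); rewrite -fM !mulg1.
Qed.

Variables (f : A -> B) (f_hom : Hom A B f).

Lemma Hom1 : f 1 = 1. Proof. by case: f_hom. Qed.

Lemma HomD : {morph f : x y / x * y}. Proof. by case: f_hom. Qed.

Lemma HomV : {morph f : x / x^-1}.
Proof. by move=> x; apply: (mulgI (f x)); rewrite -HomD !mulgV Hom1. Qed.

Lemma HomJ : {morph f : x y / x ^ y}.
Proof. by move=> x y; rewrite /conjg !HomD HomV. Qed.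

Lemma Hom_inj : (forall x, f x = 1 -> x = 1) -> injective f.
Proof.
move=> ker1 x y fxy; apply: divg1_eq; apply: ker1.
by rewrite HomD HomV fxy mulgV.
Qed.

End Homomorphisms.

(** Conjugation by [x / y] is then trivial, so [x / y] is central. *)
Lemma center1_conj_inj (A : groupType) (x y : A) :
  center A = [set 1]%classic -> (forall z : A, z ^ x = z ^ y) -> x = y.
Proof.
move=> Z1 xy; apply: divg1_eq.
have : center A (x / y).
  move=> z; apply/commute_sym/commgP/conjg_fixP.
  by rewrite conjgM xy -conjgM mulgV conjg1.
by rewrite Z1.
Qed.

(** * Normal subgroups and quotients as embeddings and projections *)

Section Extension.
Variables (H : groupType) (N : normalSubgroup H).

Lemma subgroup_embedding (G : groupType) :
  isomorphic (subgroup N) G -> exists g : G -> H,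
  [/\ Hom G H g, injective g & forall h, h \in N <-> exists u, g u = h].
Proof.
case=> f [f_hom [g fK gK]]; exists (fun u => val (g u)); split.
- apply: HomM => u v; rewrite -valM; congr val.
  by apply: (can_inj fK); rewrite (HomD f_hom) !gK.
- by move=> u v /val_inj/(can_inj gK).
- move=> h; split=> [Nh | [u <-]]; last exact: valP.
  by exists (f (exist _ h Nh)); rewrite fK.
Qed.

Lemma quotient_projection (G : groupType) :
  isomorphic (quotient N) G -> exists p : H -> G,
  [/\ Hom H G p, surjective p & forall h, h \in N <-> p h = 1].
Proof.
case=> f [f_hom [g fK gK]].
exists (fun h => f (\pi_(quotient N) h)%qT); split.
- apply: HomM => h k; rewrite -HomD //; congr f.
  by rewrite -quotient_mulE.
- by move=> y; exists (repr (g y)); rewrite -[RHS]gK; congr f; apply: reprK.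
- move=> h; rewrite -(Hom1 f_hom).
  have -> : (h \in N) = (1^-1 * h \in N) by rewrite invg1 mul1g.
  split=> [/quotient_eqP <- // | /(can_inj fK) eq1].
  exact/quotient_eqP.
Qed.

End Extension.

(** Compose [q] with a set-theoretic section of [p]: as [q] kills the kernel of [p], its values
    depend only on those of [p], which makes the composite multiplicative. *)
Lemma Hom_factor (H G K : groupType) (p : H -> G) (q : H -> K) :
  Hom H G p -> surjective p -> Hom H K q -> (forall h, p h = 1 -> q h = 1) ->
  exists2 r, Hom G K r & q = r \o p.
Proof.
move=> p_hom /choice[s sK] q_hom ker_pq.
have q_eq h k : p h = p k -> q h = q k.
  move=> hk; apply: divg1_eq; rewrite -(HomV q_hom) -(HomD q_hom).
  by apply: ker_pq; rewrite (HomD p_hom) (HomV p_hom) hk mulgV.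
exists (q \o s); last by apply/funext=> h; apply: q_eq; rewrite sK.
apply: HomM => u v /=; rewrite -(HomD q_hom).
by apply: q_eq; rewrite (HomD p_hom) !sK.
Qed.

(** * Automorphisms of a power and its coordinate copies of [L] *)

Section PowerOps.
Variables (I : Type) (L : groupType).
Implicit Types (u v : I -> L) (i : I).

Lemma powerM u v i : (u * v) i = u i * v i. Proof. by []. Qed.

Lemma powerJ u v i : (u ^ v) i = u i ^ v i. Proof. by []. Qed.

End PowerOps.

Section PowerAut.
Variables (I : choiceType) (L : groupType).
Local Notation P := (I -> L).
Implicit Types (u v : P) (phi psi : P -> P) (i j k : I) (x y z : L).

Hypothesis center1 : center L = [set 1]%classic.
Hypothesis L_neq1 : exists x : L, x <> 1.
Hypothesis EndL : forall f, Hom L L f -> (exists a, forall x, f x = x ^ a)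
  \/ forall x, f x = 1.

Definition single i x : P := fun j => if j == i then x else 1.

Lemma single_id i x : single i x i = x.
Proof. by rewrite /single eqxx. Qed.

Lemma singleM i : {morph single i : x y / x * y}.
Proof.
move=> x y; apply/funext=> j; rewrite powerM /single.
by case: ifP => // _; rewrite mul1g.
Qed.

Lemma singleJ i x u : single i x ^ u = single i (x ^ u i).
Proof.
apply/funext=> j; rewrite powerJ /single.
by case: eqP => [-> //| _]; rewrite conj1g.
Qed.

Lemma singleP i u : (forall j, j != i -> u j = 1) -> u = single i (u i).
Proof.
by move=> ui; apply/funext=> j; rewrite /single; case: eqVneq => [-> | /ui].
Qed.

Lemma center_power : center P = [set 1]%classic.
Proof.
apply/seteqP; split=> [u Zu | _ -> v]; last exact/commute_sym/commute1.
apply/funext=> i; have : center L (u i).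
  move=> x; have /(congr1 (@^~ i)) := Zu (single i x).
  by rewrite !powerM single_id.
by rewrite center1.
Qed.

(** Only inclusion of the image in the [j]-th copy is asked; bijectivity of the induced map on
    indices will come from the inverse automorphism. *)
Definition sends phi i j := forall x k, k != j -> phi (single i x) k = 1.

Lemma sends_single phi i j x :
  sends phi i j -> phi (single i x) = single j (phi (single i x) j).
Proof. by move=> phi_ij; apply/singleP/phi_ij. Qed.

Lemma sends_id i : sends id i i.
Proof. by move=> x k /negPf ki; rewrite /single ki. Qed.

Lemma sends_conj u i : sends (conjg^~ u) i i.
Proof. by move=> x k /negPf ki /=; rewrite singleJ /single ki. Qed.

Lemma sends_comp phi psi i j k :
  sends psi i j -> sends phi j k -> sends (phi \o psi) i k.
Proof. by move=> ij jk x l lk /=; rewrite (sends_single _ ij) jk. Qed.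

Section Automorphism.
Variables (phi : P -> P) (phi_hom : Hom P P phi).
Hypotheses (phi_inj : injective phi) (phi_surj : surjective phi).

Let comp i j x := phi (single i x) j.

Let comp_hom i j : Hom L L (comp i j).
Proof. by apply: HomM => x y; rewrite /comp singleM HomD. Qed.

Let phi_single_eq1 i x : phi (single i x) = 1 -> x = 1.
Proof.
rewrite -(Hom1 phi_hom) => /phi_inj/(congr1 (@^~ i)).
by rewrite single_id.
Qed.

Let comp_neq1 i : exists j, exists x, comp i j x <> 1.
Proof.
case: L_neq1 => x x1; apply: contrapT => no; apply: x1.
apply: (@phi_single_eq1 i); apply/funext=> j; apply: contrapT => c1.
by apply: no; exists j, x.
Qed.

(** An injective [phi] does not kill the [i]-th copy, and a coordinate where its image is nontrivial
    must be both [j] and [j']. *)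
Lemma sends_inj i j j' : sends phi i j -> sends phi i j' -> j = j'.
Proof.
move=> ij ij'; have [k [x]] := comp_neq1 i; rewrite /comp.
by case: (eqVneq k j) => [<-|/ij-> //]; case: (eqVneq k j') => [<-|/ij'->].
Qed.

(* The image of the [i]-th copy is normal: a commutator with the [j]-th copy
   stays in it but is trivial at [k <> j].  If [comp i k] were injective, such
   commutators would be trivial, so [comp i j] would have central image. *)
Lemma aut_sends i : exists j, sends phi i j.
Proof.
have [j [x0 jx0]] := comp_neq1 i; exists j => x k kj.
case: (EndL (comp_hom i k)) => [[a aE]|]; last exact.
case: jx0; suff : center L (comp i j x0) by rewrite center1.
move=> z; have [v phi_v] := phi_surj (single j z).
apply/commgP/eqP.
have compR l : comp i l [~ x0, v i] = [~ comp i l x0, single j z l].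
  rewrite !commgEl (HomD (comp_hom i l)) (HomV (comp_hom i l)).
  by rewrite {2}/comp -singleJ HomJ // phi_v.
have := compR k; rewrite /single (negPf kj) commg1 aE => /eqP.
by rewrite conjg_eq1 => /eqP R1; rewrite -[z](single_id j) -compR R1 Hom1.
Qed.

Lemma aut_inner : (forall i, sends phi i i) -> exists u, forall v, phi v = v ^ u.
Proof.
move=> phi_ii.
have /choice[u uE] : forall i, exists a, forall x, comp i i x = x ^ a.
  move=> i; case: (EndL (comp_hom i i)) => // c1.
  have [j [x]] := comp_neq1 i; case: (eqVneq j i) => [->|/phi_ii ji].
    by rewrite c1.
  by rewrite /comp ji.
exists u => v; apply/funext=> i; rewrite powerJ.
(* An arbitrary [v] is not a finite product of elements of the copies, so its image is read off from
   its conjugation action on the [i]-th copy, which determines a coordinate because the centre of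
   [L] is trivial. *)
have uV : v i * u i = u i * phi v i.
  apply: center1_conj_inj => // z; rewrite !conjgM -uE -uE /comp -singleJ.
  by rewrite HomJ.
by rewrite /conjg uV mulKg.
Qed.

End Automorphism.

(** Uniqueness of the target copy makes the index maps compose as the action does, so those of [h]
    and [h^-1] are mutually inverse permutations. *)
Lemma action_sends (K : groupType) (A : K -> P -> P) :
  (forall h, Hom P P (A h)) -> A 1 = id ->
  (forall h l, A (h * l) = A h \o A l) ->
  exists2 s : K -> sym I, Hom K (sym I) s & forall h i, sends (A h) i (s h i).
Proof.
move=> A_hom A1 AM.
have AK h : cancel (A h) (A h^-1).
  by move=> u; rewrite -[LHS]/((A h^-1 \o A h) u) -AM mulVg A1.
have AVK h : cancel (A h^-1) (A h) by move=> u; rewrite -{1}[h]invgK AK.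
have A_inj h := can_inj (AK h).
have A_surj h : surjective (A h) by move=> u; exists (A h^-1 u); apply: AVK.
have /choice[t tE] : forall h, exists t, forall i, sends (A h) i (t i).
  move=> h; have /choice[t] := aut_sends (A_hom h) (@A_inj _) (@A_surj _).
  by exists t.
have tM h l i : t (h * l) i = t h (t l i).
  apply: (sends_inj (A_hom (h * l)) (@A_inj _) (tE _ _)).
  by rewrite AM; apply: sends_comp.
have t1 i : t 1 i = i.
  apply: (sends_inj (A_hom 1) (@A_inj _) (tE _ _)).
  by rewrite A1; apply: sends_id.
have t_bij h : bijective (t h).
  by exists (t h^-1) => i; rewrite -tM ?mulVg ?mulgV t1.
exists (fun h => sym_of (t_bij h)); last exact: tE.
by apply: HomM => h l; apply/val_inj/funext=> i; apply: tM.
Qed.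

End PowerAut.

Section RigidExtension.
Variables (L : groupType) (L_rigid : rigid L).
Local Notation G := (nat -> L).
Variables (H : groupType) (g : G -> H) (p : H -> G).
Hypotheses (g_hom : Hom G H g) (g_inj : injective g).
Hypotheses (p_hom : Hom H G p) (p_surj : surjective p).
Hypothesis exact : forall h, p h = 1 <-> exists u, g u = h.

Let center1 : center L = [set 1]%classic.
Proof. by case: L_rigid => _ []. Qed.

Let L_neq1 : exists x : L, x <> 1.
Proof.
case: L_rigid => L1 _ _ _; apply: contrapT => no; apply: L1.
by apply/seteqP; split=> // x _; apply: contrapT => x1; apply: no; exists x.
Qed.

Let EndL f : Hom L L f -> (exists a, forall x, f x = x ^ a)
  \/ forall x, f x = 1.
Proof.
case: L_rigid => _ _ _ EndE f_hom; have : End L f by [].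
by rewrite EndE => -[[a ->]|->]; [left; exists a | right].
Qed.

Lemma extension_inner h : exists u, forall v, g v ^ h = g (v ^ u).
Proof.
have gJ k v : exists u, g u = g v ^ k^-1.
  apply/exact; rewrite (HomJ p_hom).
  by have /exact-> : exists u, g u = g v; [exists v | rewrite conj1g].
(* Conjugation is a right action; the inverse turns it into a left action, as composition in
   [sym nat] requires. *)
have /choice[A AE] : forall k, exists A : G -> G, forall v, g (A v) = g v ^ k^-1.
  by move=> k; have /choice[A] := gJ k; exists A.
have A_hom k : Hom G G (A k).
  apply: HomM => u v; apply: g_inj; rewrite (HomD g_hom) !AE.
  by rewrite (HomD g_hom) conjMg.
have A_inj k : injective (A k).
  by move=> u v /(congr1 g); rewrite !AE => /conjg_inj/g_inj.
have A1 : A 1 = id.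
  by apply/funext=> v; apply: g_inj; rewrite AE invg1 conjg1.
have AM k l : A (k * l) = A k \o A l.
  by apply/funext=> v; apply: g_inj; rewrite !AE invgM conjgM.
have [s s_hom sE] := action_sends center1 L_neq1 EndL A_hom A1 AM.
(* An element of the kernel acts by an inner automorphism of the power, which preserves every
   copy. *)
have ker_ps k : p k = 1 -> s k = 1.
  move=> /exact[u gu]; apply/val_inj/funext=> i.
  apply: (sends_inj L_neq1 (A_hom k) (@A_inj k) (sE k i)).
  have -> : A k = conjg^~ u^-1; last exact: sends_conj.
  by apply/funext=> v; apply: g_inj; rewrite AE -gu -(HomV g_hom) (HomJ g_hom).
have [r r_hom sr] := Hom_factor p_hom p_surj s_hom ker_ps.
have s1 k i : s k i = i.
  by case: L_rigid => _ _ Hom0 _; move: r_hom; rewrite Hom0 sr => ->.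
have [|u uE] := aut_inner center1 L_neq1 EndL (A_hom h^-1) (@A_inj _).
  by move=> i; rewrite -[X in sends _ _ X](s1 h^-1).
by exists u => v; rewrite -uE AE invgK.
Qed.

(** Sending [h] to the unique [u] that conjugates as [h] does gives a retraction [q] of [H] onto the
    kernel, so [q] and [p] together identify [H] with a direct square of the power. *)
Lemma extension_split : isomorphic H G.
Proof.
have /choice[q qE] := extension_inner.
have q_uniq h u : (forall v, g v ^ h = g (v ^ u)) -> q h = u.
  move=> hu; apply: center1_conj_inj (center_power _ center1) _ => v.
  by apply: g_inj; rewrite -qE.
have qM : {morph q : h k / h * k}.
  by move=> h k; apply: q_uniq => v; rewrite !conjgM !qE.
have q_hom : Hom H G q by apply: HomM.
have qg u : q (g u) = u by apply: q_uniq => v; rewrite (HomJ g_hom).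
have pg u : p (g u) = 1 by apply/exact; exists u.
(* Interleaving identifies the square with the power: even coordinates carry [q h], odd ones
   [p h]. *)
pose f h : G := fun n => if odd n then p h n./2 else q h n./2.
have f_hom : Hom H G f.
  apply: HomM => h k; apply/funext=> n; rewrite powerM /f.
  by rewrite qM (HomD p_hom); case: ifP.
have fodd h n : f h n.*2.+1 = p h n by rewrite /f /= odd_double /= uphalf_double.
have feven h n : f h n.*2 = q h n by rewrite /f odd_double doubleK.
exists f; split=> //; apply: inj_surj_bij.
  apply: Hom_inj => // h fh1.
  have /exact[u gu] : p h = 1 by apply/funext=> n; rewrite -fodd fh1.
  have q1 : q h = 1 by apply/funext=> n; rewrite -feven fh1.
  by rewrite -gu -[u]qg gu q1 Hom1.
move=> w; have [h ph] := p_surj (fun n => w n.*2.+1).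
(* The lift [h] has the right odd coordinates; the left factor from the kernel corrects [q] without
   changing [p]. *)
exists (g ((fun n => w n.*2) / q h) * h); apply/funext=> n.
rewrite /f qM qg mulgVK (HomD p_hom) pg mul1g ph -[n in RHS]odd_double_half.
by case: (odd n).
Qed.

End RigidExtension.

Theorem corollary1p5 (L : groupType) (L_rigid : rigid L) : HallGroup (nat -> L).
Proof.
move=> H N /subgroup_embedding[g [g_hom g_inj gN]].
move=> /quotient_projection[p [p_hom p_surj pN]].
by apply: (extension_split L_rigid g_hom g_inj p_hom p_surj) => h; rewrite -pN.
Qed.
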